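(* Suppose that $\mathrm{zer}(\Phi)\neq\emptyset$, $F$ is $L$-Lipschitz continuous, and $\Phi$ is $\rho$-co-hypomonotone. Let $\kappa\ge0,\hat\kappa\ge0$ satisfy $128[(1+4\kappa)L^2+2\hat\kappa]\rho^2<1$. Let $\{(x^k,y^k)\}$ be generated by the scheme (GFEG$_+$) described in the context, with $u^0=Fx^0$ and directions $u^k$ satisfying, for all $k\ge1$, $$\|Fx^k-u^k\|^2\le\kappa\|Fx^k-Fy^{k-1}\|^2+\hat\kappa\eta^2\|\hat w^k-(1-\tau_{k-1})w^{k-1}\|^2,$$ and with parameters $$\tau_k:=\frac1{t_k}=\frac1{\mu(k+r)},\qquad\hat\eta_k:=\eta(1-\tau_k),\qquad\beta_k:=-\gamma\tau_k+4\rho(1-\tau_k),$$ where $\mu\in(0,\frac12)$ and $r\ge1+\frac2\mu$ are given, and $\eta$ and $\gamma$ are chosen such that $$8\rho<\eta\le\bar\eta:=\frac1{\sqrt{2(1+4\kappa)L^2+4\hat\kappa}}\qquad\text{and}\qquad\gamma:=\frac{(1-2\mu)\eta}{6}.$$ Then, for any $x^\star\in\mathrm{zer}(\Phi)$ and all $k\ge0$, $$\|Fx^k+\xi^k\|^2\le\frac{6e^{\theta/r}\,\mathcal R_0^2}{\eta\mu^2(k+r-1)^2},$$ where $\theta:=\frac{(1-2\mu)(1-\mu)^2}{2(2-\mu)\mu^2}$ and $\mathcal R_0^2:=\frac{\eta\mu^2(r-1)^2}{2}\|Fx^0+\xi^0\|^2+\frac{3(1-\mu)}{(1-2\mu)\eta}\|x^0-x^\star\|^2$.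 Moreover, $$\sum_{k=0}^\infty[\mu(k+r)-1]\,\|Fx^k+\xi^k\|^2\le\frac{4\mathcal R_0^2}{(3-2\mu)(\eta-8\rho)}\Big(1+\frac\theta re^{\theta/r}\Big).$$
   Context: $\mathbb R^p$ carries the standard inner product and Euclidean norm. $F:\mathbb R^p\to\mathbb R^p$ is single-valued, $T:\mathbb R^p\rightrightarrows2^{\mathbb R^p}$ is set-valued, $\Phi:=F+T$, $\mathrm{zer}(\Phi)=\{x:0\in Fx+Tx\}$. For $\rho\ge0$, $\Phi$ is $\rho$-co-hypomonotone if $\langle u-v,x-y\rangle\ge-\rho\|u-v\|^2$ for all $(x,u),(y,v)\in\mathrm{gra}(\Phi)$. $F$ is $L$-Lipschitz continuous if $\|Fx-Fy\|\le L\|x-y\|$ for all $x,y$. Scheme (GFEG$_+$): start from $x^0\in\mathrm{dom}(\Phi)$, $\bar x^0:=x^0$, $\xi^0\in Tx^0$ arbitrary, $y^{-1}=x^{-1}:=x^0$, $u^0:=Fx^0$. With elements $\xi^k\in Tx^k$ put $w^k:=Fx^k+\xi^k$, $\hat w^k:=Fy^{k-1}+\xi^k$, $z^k:=u^k+\xi^k$. For $k\ge0$: $$y^k:=x^k+\tau_k(\bar x^k-x^k)-(\hat\eta_k-\beta_k)z^k,\quad x^{k+1}:=x^k+\tau_k(\bar x^k-x^k)-\eta\hat w^{k+1}+\beta_kz^k,\quad\bar x^{k+1}:=\bar x^k-\gamma z^k,$$ where the second (implicit) line means that $x^{k+1}$ and some $\xi^{k+1}\in Tx^{k+1}$ satisfy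 the displayed equation with $\hat w^{k+1}=Fy^k+\xi^{k+1}$ (this is the element $\xi^{k+1}$ used thereafter). ''Generated by'' means these relations hold for all $k\ge0$. *)

(* Defs.v *)
From mathcomp Require Import all_boot all_order all_algebra.
From mathcomp Require Import all_classical all_reals all_analysis.

Set Implicit Arguments.
Unset Strict Implicit.
Unset Printing Implicit Defensive.

Import Order.TTheory GRing.Theory Num.Theory.
Import numFieldNormedType.Exports.

Local Open Scope classical_set_scope.
Local Open Scope ring_scope.

Section Euclidean.
Context {R : realType} {p : nat}.
Implicit Types (a b : 'rV[R]_p) (F : 'rV[R]_p -> 'rV[R]_p).

Definition dotv a b : R := \sum_(i < p) a 0 i * b 0 i.

(* The canonical norm `|a| on 'rV[R]_p is the sup norm, hence this one. *)
Definition enorm a : R := Num.sqrt (dotv a a).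

Definition lipschitz_cont F (L : R) : Prop :=
  forall a b, enorm (F a - F b) <= L * enorm (a - b).

End Euclidean.

Section SetValued.
Context {R : realType} {p : nat}.
Implicit Types (F : 'rV[R]_p -> 'rV[R]_p) (A T : 'rV[R]_p -> set 'rV[R]_p).

Definition op_sum F T : 'rV[R]_p -> set 'rV[R]_p :=
  fun a => [set F a + v | v in T a].

Definition op_dom A : set 'rV[R]_p := [set a | A a !=set0].

Definition op_gra A : set ('rV[R]_p * 'rV[R]_p) := [set q | A q.1 q.2].

Definition zer A : set 'rV[R]_p := [set a | A a 0].

Definition co_hypomonotone A (rho : R) : Prop :=
  forall a u b v, op_gra A (a, u) -> op_gra A (b, v) ->
    dotv (u - v) (a - b) >= - rho * enorm (u - v) ^+ 2.

End SetValued.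

Section Scheme.
Context {R : realType} {p : nat}.
Local Notation V := 'rV[R]_p.
Context (F : V -> V) (x y u xi : nat -> V).

(* [y_pred k] is y^(k-1), with y^(-1) := x^0. *)
Definition y_pred (k : nat) : V := if k is k'.+1 then y k' else x 0%N.

Definition w_dir (k : nat) : V := F (x k) + xi k.

Definition what_dir (k : nat) : V := F (y_pred k) + xi k.

Definition z_dir (k : nat) : V := u k + xi k.

End Scheme.

Section GFEG.
Context {R : realType} {p : nat}.
Local Notation V := 'rV[R]_p.

Record GFEGp (F : V -> V) (T : V -> set V) (eta gamma : R)
    (tau etahat beta : nat -> R) (x xbar y u xi : nat -> V) : Prop := {
  GFEGp_dom : op_dom (op_sum F T) (x 0%N);
  GFEGp_xbar0 : xbar 0%N = x 0%N;
  GFEGp_u0 : u 0%N = F (x 0%N);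
  GFEGp_xi : forall k, T (x k) (xi k);
  GFEGp_y : forall k,
    y k = x k + tau k *: (xbar k - x k)
          - (etahat k - beta k) *: z_dir u xi k;
  GFEGp_x : forall k,
    x k.+1 = x k + tau k *: (xbar k - x k)
             - eta *: what_dir F x y xi k.+1 + beta k *: z_dir u xi k;
  GFEGp_xbar : forall k, xbar k.+1 = xbar k - gamma *: z_dir u xi k
}.

Definition direction_cond (F : V -> V) (kappa kappahat eta : R)
    (tau : nat -> R) (x y u xi : nat -> V) : Prop :=
  forall k, (1 <= k)%N ->
    enorm (F (x k) - u k) ^+ 2 <=
      kappa * enorm (F (x k) - F (y_pred x y k)) ^+ 2
      + kappahat * eta ^+ 2 *
        enorm (what_dir F x y xi k
               - (1 - tau k.-1) *: w_dir F x xi k.-1) ^+ 2.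

End GFEG.

Section StepSizes.
Context {R : realType}.
Implicit Types (mu r eta gamma rho L kappa kappahat : R).

Definition tau_par mu r (k : nat) : R := 1 / (mu * (k%:R + r)).

Definition etahat_par eta mu r (k : nat) : R := eta * (1 - tau_par mu r k).

Definition beta_par gamma rho mu r (k : nat) : R :=
  - gamma * tau_par mu r k + 4 * rho * (1 - tau_par mu r k).

(* Extended-real quotient: 1 / 0 = +oo when L = 0 and kappahat = 0, i.e. the
   upper bound on the step size is then void. *)
Definition eta_bar L kappa kappahat : \bar R :=
  (1%:E / (Num.sqrt (2 * (1 + 4 * kappa) * L ^+ 2 + 4 * kappahat))%:E)%E.

Definition theta_par mu : R :=
  ((1 - 2 * mu) * (1 - mu) ^+ 2) / (2 * (2 - mu) * mu ^+ 2).

End StepSizes.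

Definition R0sq {R : realType} {p : nat} (eta mu r : R)
    (w0 x0 xstar : 'rV[R]_p) : R :=
  eta * mu ^+ 2 * (r - 1) ^+ 2 / 2 * enorm w0 ^+ 2
  + 3 * (1 - mu) / ((1 - 2 * mu) * eta) * enorm (x0 - xstar) ^+ 2.

(* Main.v *)
Require Import Defs.
From mathcomp Require Import all_boot all_order all_algebra.
From mathcomp Require Import all_classical all_reals all_analysis.
From mathcomp Require Import ring lra.

Set Implicit Arguments.
Unset Strict Implicit.
Unset Printing Implicit Defensive.

Import Order.TTheory GRing.Theory Num.Theory.
Import numFieldNormedType.Exports.

Local Open Scope classical_set_scope.
Local Open Scope ring_scope.

(** The argument is a Lyapunov analysis.  Write [w] for the residual
    [F x + xi], [e := F x - u] for the direction error, [q := x - xbar],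
    [X := xbar - xstar], [t := mu (k + r)] and [s := t - mu], the previous
    value of [t].  The potential is
    [V := (eta/2 s^2 - 2 rho s (s-1)) |w|^2 + s <w, q>
          + c |X|^2 + 2 eta s^2 |e|^2]
    with [c := 3 (1 - mu) / ((1 - 2 mu) eta) = (1 - mu) / (2 gamma)].

    The implicit step turns co-hypomonotonicity between two consecutive
    iterates, weighted by [t (t - 1)], into a recursion for [s <w, q>].  That
    recursion leaves over [- (1 - mu) <w, q>], which co-hypomonotonicity
    against the zero [xstar] bounds by [(1 - mu) <w, X>] up to [rho |w|^2];
    the choice of [c] makes the latter cancel against the variation of
    [c |X|^2], except for the direction error [(1 - mu) <e, X>].  The
    extrapolation error [|F x' - F y|^2] is absorbed by the Lipschitz bound and
    the restriction on [eta] ([direction_error]), and all other terms are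
    controlled by completing squares ([lyapunov_step]):
    [V' + (3 - 2 mu)(eta - 8 rho)/4 (t - 1) |w|^2
       <= V + (1 - mu) <e, X> - eta/2 t^2 |e|^2].

    By Young's inequality the remaining error is at most a multiple of
    [|X|^2 / t^2], and [V] dominates [|X|^2] ([lyapunov_ge_anchor]), so the
    potential grows at most by the factor [1 + theta / (k + r)^2].  No growth
    takes place at [k = 0], where the direction is exact; hence the sum of the
    growth rates is at most [theta / r], and the discrete Gronwall inequality
    ([discrete_gronwall]) bounds both the potential and the total dissipation.
    The residual estimate then follows because [V] also dominates
    [eta/6 s^2 |w|^2] ([lyapunov_ge_residual]). *)

(** * The Euclidean inner product *)

Section InnerProduct.
Context {R : realType} {p : nat}.
Implicit Types a b c : 'rV[R]_p.

Lemma dotvC a b : dotv a b = dotv b a.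
Proof. by apply: eq_bigr => i _; rewrite mulrC. Qed.

Lemma dotvDl a b c : dotv (a + b) c = dotv a c + dotv b c.
Proof.
by rewrite -big_split; apply: eq_bigr => i _; rewrite !mxE mulrDl.
Qed.

Lemma dotvZl (l : R) a b : dotv (l *: a) b = l * dotv a b.
Proof.
by rewrite /dotv mulr_sumr; apply: eq_bigr => i _; rewrite !mxE mulrA.
Qed.

Lemma dotvNl a b : dotv (- a) b = - dotv a b.
Proof. by rewrite -scaleN1r dotvZl mulN1r. Qed.

Lemma dotvDr a b c : dotv a (b + c) = dotv a b + dotv a c.
Proof. by rewrite dotvC dotvDl !(dotvC a). Qed.

Lemma dotvZr (l : R) a b : dotv a (l *: b) = l * dotv a b.
Proof. by rewrite dotvC dotvZl dotvC. Qed.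

Lemma dotvNr a b : dotv a (- b) = - dotv a b.
Proof. by rewrite dotvC dotvNl dotvC. Qed.

Definition dotvE := (dotvDl, dotvDr, dotvNl, dotvNr, dotvZl, dotvZr).

Lemma dotvv_ge0 a : 0 <= dotv a a.
Proof. by apply: sumr_ge0 => i _; rewrite -expr2 sqr_ge0. Qed.

Lemma enorm_sqr a : enorm a ^+ 2 = dotv a a.
Proof. exact/sqr_sqrtr/dotvv_ge0. Qed.

Lemma dotv0l a : dotv 0 a = 0.
Proof. by rewrite -(scale0r 0) dotvZl mul0r. Qed.

(** Squaring is legitimate whatever the sign of [L], since the norm on the left
    forces the right-hand side to be nonnegative. *)
Lemma lipschitz_cont_sqr (F : 'rV[R]_p -> 'rV[R]_p) (L : R) a b :
  lipschitz_cont F L ->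
  dotv (F a - F b) (F a - F b) <= L ^+ 2 * dotv (a - b) (a - b).
Proof.
move=> /(_ a b) FL; rewrite -!enorm_sqr -exprMn.
have F0 : 0 <= enorm (F a - F b) := sqrtr_ge0 _.
by rewrite ler_sqr ?nnegrE //; exact: le_trans FL.
Qed.

End InnerProduct.

(** * The extrapolation error *)

Section StepSize.
Context {R : realType} {p : nat}.
Implicit Types eta L kappa kappahat : R.

(** When the radicand vanishes, [eta_bar] is [+oo] and the left-hand side is
    zero. *)
Lemma eta_bar_sqr eta L kappa kappahat :
  0 <= eta -> 0 <= kappa -> 0 <= kappahat ->
  (eta%:E <= eta_bar L kappa kappahat)%E ->
  eta ^+ 2 * (2 * (1 + 4 * kappa) * L ^+ 2 + 4 * kappahat) <= 1.
Proof.
move=> eta0 k0 kh0; rewrite /eta_bar; set m := _ + 4 * kappahat.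
have m0 : 0 <= m.
  by have := sqr_ge0 L; have := mulr_ge0 k0 (sqr_ge0 L); rewrite /m; lra.
have [/eqP ->|sm0] := boolP (m == 0); first by rewrite mulr0.
have s0 : 0 < Num.sqrt m by rewrite sqrtr_gt0 lt_def sm0.
rewrite inver gt_eqF// -EFinM lee_fin mul1r => h.
rewrite -(sqr_sqrtr m0) -exprMn expr_le1// ?mulr_ge0 ?sqrtr_ge0//.
by rewrite -ler_pdivlMr// div1r.
Qed.

(** Used with [b := t (w' - a)], where [a := F y + xi'] is the extrapolated
    residual, [g := t a - (t - 1) w], [f := (t - 1) e], and [e] standing for
    [t e'].  As [x' - y] is a multiple of [g + f], the Lipschitz bound gives
    [|b|^2 <= 2 (L eta)^2 (|g|^2 + |f|^2)]; the factor 4 in front of the new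
    direction error is paid for by [1 + 4 kappa] and [4 kappahat] in the
    restriction on the step size. *)
Lemma direction_error eta L kappa kappahat (b g f e : 'rV[R]_p) :
  0 <= kappa -> 0 <= kappahat ->
  eta ^+ 2 * (2 * (1 + 4 * kappa) * L ^+ 2 + 4 * kappahat) <= 1 ->
  dotv b b <= (L * eta) ^+ 2 * dotv (g + f) (g + f) ->
  dotv e e <= kappa * dotv b b + kappahat * eta ^+ 2 * dotv g g ->
  dotv b b + 4 * dotv e e <= dotv g g + dotv f f.
Proof.
move=> k0 kh0 step hb he.
have gf : dotv (g + f) (g + f) <= 2 * (dotv g g + dotv f f).
  by have := dotvv_ge0 (g - f); rewrite !dotvE (dotvC f g); lra.
have {gf hb} hb : dotv b b <= (L * eta) ^+ 2 * (2 * (dotv g g + dotv f f)).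
  by apply: le_trans hb _; rewrite ler_wpM2l ?sqr_ge0.
have h1 : 0 <= (1 + 4 * kappa)
    * ((L * eta) ^+ 2 * (2 * (dotv g g + dotv f f)) - dotv b b).
  by rewrite mulr_ge0//; lra.
have h2 : 0 <= (1 - eta ^+ 2 * (2 * (1 + 4 * kappa) * L ^+ 2 + 4 * kappahat))
    * (dotv g g + dotv f f).
  by rewrite mulr_ge0 ?subr_ge0 ?addr_ge0 ?dotvv_ge0.
have h3 : 0 <= kappahat * eta ^+ 2 * dotv f f.
  by rewrite mulr_ge0 ?dotvv_ge0// mulr_ge0 ?sqr_ge0.
lra.
Qed.

End StepSize.

(** * The Lyapunov function *)

Section Lyapunov.
Context {R : realType} {p : nat}.
Implicit Types (eta rho mu s t gamma : R) (w a e q d X : 'rV[R]_p).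

(** [s] is the value of [t] one iteration earlier.  The coefficient of
    [|X|^2] is [(1 - mu) / (2 gamma)]; the last term stores the direction
    error of the current iterate, to be spent in the next one. *)
Definition lyapunov eta rho mu s w q X e : R :=
  (eta / 2 * s ^+ 2 - 2 * rho * s * (s - 1)) * dotv w w
  + s * dotv w q
  + 3 * (1 - mu) / ((1 - 2 * mu) * eta) * dotv X X
  + 2 * eta * s ^+ 2 * dotv e e.

(** The coefficient of [|w|^2] left in [lyapunov_step] once the squares are
    completed.  Substituting [gamma] shows that it equals
    [gamma/4 (t - 2 + mu) + (1 - mu) rho
     + (1 - mu)/2 ((eta - 4 rho)(1 - mu) - gamma)]. *)
Lemma residual_coef_ge0 eta rho mu t gamma :
  0 < mu < 1 / 2 -> 2 + mu <= t -> 0 <= rho -> 8 * rho < eta ->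
  gamma = (1 - 2 * mu) * eta / 6 ->
  0 <= (eta / 2 - 2 * rho) * (t - mu) ^+ 2 + 2 * rho * (t - mu)
    - (eta / 2 - 2 * rho) * (t - 1) ^+ 2 - 2 * rho * (t - 1) - (1 - mu) * rho
    - gamma * (t - 1) - (1 - mu) * gamma / 2
    - (3 - 2 * mu) * (eta - 8 * rho) / 4 * (t - 1)
    - 2 * rho * (t - 1) - gamma / 4 * ((t - 1) + (1 - mu)).
Proof.
move=> /andP[mu0 mu12] t2 rho0 rhoeta gammaE.
have eta0 : 0 < eta by lra.
have gamma0 : 0 < gamma by rewrite gammaE divr_gt0 ?mulr_gt0//; lra.
suff : 0 <= gamma / 4 * (t - 2 + mu) + (1 - mu) * rho
    + (1 - mu) / 2 * ((eta - 4 * rho) * (1 - mu) - gamma).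
  by rewrite gammaE; lra.
have h1 : 0 <= (eta - 8 * rho) * (1 - mu) by rewrite mulr_ge0//; lra.
have h2 : 0 <= eta * (1 / 2 - mu) by rewrite mulr_ge0//; lra.
have h3 : 0 <= (eta - 4 * rho) * (1 - mu) - gamma by rewrite gammaE; lra.
by rewrite !addr_ge0 ?mulr_ge0//; lra.
Qed.

(** The coefficient of [|e|^2] left in [lyapunov_step]: of the stored
    [2 eta (t - mu)^2], the extrapolation error takes [eta/2 (t - 1)^2], the
    Young inequality against [X] will take [eta/2 t^2], and the completed
    squares take the rest. *)
Lemma error_coef_ge0 eta rho mu t gamma :
  0 < mu < 1 / 2 -> 2 + mu <= t -> 0 <= rho -> 8 * rho < eta ->
  gamma = (1 - 2 * mu) * eta / 6 ->
  0 <= 2 * eta * (t - mu) ^+ 2 - eta / 2 * (t - 1) ^+ 2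
    - eta / 2 * t ^+ 2 - 4 * rho * t * (t - 1) - 2 * rho * (t - 1)
    - gamma * ((t - 1) + (1 - mu)) - (1 - mu) * gamma / 2.
Proof.
move=> /andP[mu0 mu12] t2 rho0 rhoeta gammaE.
have eta0 : 0 < eta by lra.
have h1 : 0 <= (eta - 8 * rho) * ((t - 1) * (2 * t + 1)).
  by rewrite !mulr_ge0//; lra.
have h2 : 0 <= (eta * mu) * (t - mu + (1 - mu) / 2).
  by rewrite !mulr_ge0//; lra.
have h3 : 0 <= eta * (2 * (t - mu) ^+ 2 - (t - 1) ^+ 2 / 2 - t ^+ 2 / 2
   - (t - 1) * (2 * t + 1) / 4 - (t - mu + (1 - mu) / 2) / 6).
  by rewrite mulr_ge0 ?ltW//; nra.
by rewrite gammaE; lra.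
Qed.

(** Here [d] is [x' - x], and the arguments of the potential on the left are
    [x' - xbar'] and [xbar' - xstar].  The proof is a linear combination of the
    two co-hypomonotonicity inequalities, with weights [t (t - 1)] and
    [1 - mu], of the extrapolation bound with weight [eta / 2], and of squares.
    The polarization of [<a, t w' - (t - 1) w>] produces the leading
    coefficient [eta/2] of the potential, and the term [4 rho] in the scheme
    converts [rho t (t - 1) |w' - w|^2] into terms in [|w|^2] and [|w'|^2]
    while leaving a negative multiple of [|w' - w|^2]. *)
Lemma lyapunov_step eta rho mu t gamma w w' a e e' q d X :
  0 < mu < 1 / 2 -> 2 + mu <= t -> 0 <= rho -> 8 * rho < eta ->
  gamma = (1 - 2 * mu) * eta / 6 ->
  t *: d = - q - (t * eta) *: a + (4 * rho * (t - 1) - gamma) *: (w - e) ->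
  - rho * dotv (w' - w) (w' - w) <= dotv (w' - w) d ->
  - rho * dotv w w <= dotv w (q + X) ->
  t ^+ 2 * (dotv (w' - a) (w' - a) + 4 * dotv e' e') <=
    dotv (t *: a - (t - 1) *: w) (t *: a - (t - 1) *: w)
    + (t - 1) ^+ 2 * dotv e e ->
  lyapunov eta rho mu t w' (q + d + gamma *: (w - e)) (X - gamma *: (w - e)) e'
  + (3 - 2 * mu) * (eta - 8 * rho) / 4 * ((t - 1) * dotv w w) <=
  lyapunov eta rho mu (t - mu) w q X e
  + (1 - mu) * dotv e X - eta / 2 * t ^+ 2 * dotv e e.
Proof.
move=> mu_in t2 rho0 rhoeta gammaE dE mono mono0 err.
have /andP[mu0 mu12] := mu_in; have eta0 : 0 < eta by lra.
have gamma0 : 0 < gamma by rewrite gammaE divr_gt0 ?mulr_gt0//; lra.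
have dw' := congr1 (dotv w') dE.
have dw := congr1 (dotv w) dE.
(* The direction error enters through the products with [w' - w] and [w]; the
   three squares below are those that absorb these cross terms. *)
have y1 : 0 <= rho * t * (t - 1) * dotv (w' - w + 2 *: e) (w' - w + 2 *: e).
  by rewrite mulr_ge0 ?dotvv_ge0// !mulr_ge0//; lra.
have y2 : 0 <= 2 * rho * (t - 1) * dotv (w + e) (w + e).
  by rewrite mulr_ge0 ?dotvv_ge0// !mulr_ge0//; lra.
have y3 : 0 <= gamma / 4 * ((t - 1) + (1 - mu))
   * dotv (w + 2 *: e) (w + 2 *: e).
  by rewrite mulr_ge0 ?dotvv_ge0// !mulr_ge0//; lra.
have m1 : 0 <= t * (t - 1) * (dotv (w' - w) d + rho * dotv (w' - w) (w' - w)).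
  by rewrite mulr_ge0 ?mulr_ge0//; lra.
have m2 : 0 <= (1 - mu) * (dotv w (q + X) + rho * dotv w w).
  by rewrite mulr_ge0//; lra.
have m3 := ler_wpM2l (ltW (divr_gt0 eta0 (ltr0Sn R 1))) err.
have ww := dotvv_ge0 w; have ee := dotvv_ge0 e.
have cw := mulr_ge0 (residual_coef_ge0 mu_in t2 rho0 rhoeta gammaE) ww.
have ce := mulr_ge0 (error_coef_ge0 mu_in t2 rho0 rhoeta gammaE) ee.
rewrite /lyapunov.
set c := 3 * (1 - mu) / _.
(* The relation that makes the products of [w] with [X] cancel. *)
have cE : c * gamma = (1 - mu) / 2.
  by rewrite /c gammaE; field; apply/andP; split; lra.
have cz : c * gamma * gamma * dotv (w - e) (w - e)
    = (1 - mu) / 2 * gamma * dotv (w - e) (w - e) by rewrite cE.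
have cX : c * gamma * dotv X (w - e) = (1 - mu) / 2 * dotv X (w - e).
  by rewrite cE.
rewrite !dotvE (dotvC w' w) (dotvC e w) (dotvC e w') (dotvC a w)
  (dotvC a w') ?(dotvC w X) ?(dotvC e X) in dw' dw y1 y2 y3 m1 m2 m3 cz cX *.
have {}dw' := congr1 ( *%R t) dw'.
have {}dw := congr1 ( *%R (t - 1)) dw.
clear - dw' dw y1 y2 y3 m1 m2 m3 cz cX cw ce.
clearbody c.
lra.
Qed.

(** As [8 rho < eta], the coefficient of [|w|^2] in the potential is at least
    [eta/4 s^2 + 2 rho s], and [2 rho s] outweighs the loss [rho s] incurred
    when [<w, q>] is replaced by [- <w, X>]. *)
Lemma lyapunov_minorant eta rho mu s w q X e :
  0 < eta -> 0 <= rho -> 8 * rho < eta -> 0 <= s ->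
  - rho * dotv w w <= dotv w (q + X) ->
  eta / 4 * s ^+ 2 * dotv w w - s * dotv w X
  + 3 * (1 - mu) / ((1 - 2 * mu) * eta) * dotv X X
  <= lyapunov eta rho mu s w q X e.
Proof.
move=> eta0 rho0 rhoeta s0; rewrite dotvDr => mono.
have ww := dotvv_ge0 w.
have m : 0 <= s * (dotv w q + dotv w X + rho * dotv w w).
  by rewrite mulr_ge0//; lra.
have h1 : 0 <= (eta - 8 * rho) * (s ^+ 2 * dotv w w).
  by rewrite mulr_ge0 ?mulr_ge0 ?sqr_ge0//; lra.
have h2 : 0 <= rho * s * dotv w w by rewrite !mulr_ge0.
have h3 : 0 <= eta * s ^+ 2 * dotv e e.
  by rewrite !mulr_ge0 ?dotvv_ge0// ltW.
by rewrite /lyapunov; move: (3 * (1 - mu) / _) => c; lra.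
Qed.

(** Complete the square in [eta/12 s^2 |w|^2 - s <w, X> + 3/eta |X|^2]: the
    coefficient of [|X|^2] in the potential is at least [3 / eta]. *)
Lemma lyapunov_ge_residual eta rho mu s w q X e :
  0 < mu < 1 / 2 -> 0 <= rho -> 8 * rho < eta -> 0 <= s ->
  - rho * dotv w w <= dotv w (q + X) ->
  eta / 6 * s ^+ 2 * dotv w w <= lyapunov eta rho mu s w q X e.
Proof.
move=> /andP[mu0 mu12] rho0 rhoeta s0 mono.
have eta0 : 0 < eta by lra.
apply: le_trans (lyapunov_minorant mu e eta0 rho0 rhoeta s0 mono).
have XX := dotvv_ge0 X.
have c_ge : 3 / eta * dotv X X
    <= 3 * (1 - mu) / ((1 - 2 * mu) * eta) * dotv X X.
  rewrite ler_wpM2r// -subr_ge0.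
  rewrite (_ : _ - _ = 3 * mu / ((1 - 2 * mu) * eta)); last first.
    by field; apply/andP; split; lra.
  by rewrite divr_ge0 ?mulr_ge0//; lra.
have sq : 0 <= (12 * eta)^-1 *
    dotv (eta * s *: w - 6 *: X) (eta * s *: w - 6 *: X).
  by rewrite mulr_ge0 ?dotvv_ge0// invr_ge0 mulr_ge0//; lra.
have sqE : (12 * eta)^-1 *
    dotv (eta * s *: w - 6 *: X) (eta * s *: w - 6 *: X) =
    eta / 12 * s ^+ 2 * dotv w w - s * dotv w X + 3 / eta * dotv X X.
  by rewrite !dotvE (dotvC X w); field; lra.
lra.
Qed.

(** Complete the square in [eta/4 s^2 |w|^2 - s <w, X> + 1/eta |X|^2]; the
    constant is what remains of the coefficient of [|X|^2] after removing
    [1 / eta], and it determines [theta]. *)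
Lemma lyapunov_ge_anchor eta rho mu s w q X e :
  0 < mu < 1 / 2 -> 0 <= rho -> 8 * rho < eta -> 0 <= s ->
  - rho * dotv w w <= dotv w (q + X) ->
  (2 - mu) / ((1 - 2 * mu) * eta) * dotv X X <=
    lyapunov eta rho mu s w q X e.
Proof.
move=> /andP[mu0 mu12] rho0 rhoeta s0 mono.
have eta0 : 0 < eta by lra.
apply: le_trans (lyapunov_minorant mu e eta0 rho0 rhoeta s0 mono).
have cE : 3 * (1 - mu) / ((1 - 2 * mu) * eta)
    = (2 - mu) / ((1 - 2 * mu) * eta) + eta^-1.
  by field; apply/andP; split; lra.
have sq : 0 <= (4 * eta)^-1 *
    dotv (eta * s *: w - 2 *: X) (eta * s *: w - 2 *: X).
  by rewrite mulr_ge0 ?dotvv_ge0// invr_ge0 mulr_ge0//; lra.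
have sqE : (4 * eta)^-1 *
    dotv (eta * s *: w - 2 *: X) (eta * s *: w - 2 *: X) =
    eta / 4 * s ^+ 2 * dotv w w - s * dotv w X + eta^-1 * dotv X X.
  by rewrite !dotvE (dotvC X w); field; lra.
by rewrite cE; move: ((2 - mu) / _) => c; lra.
Qed.

Lemma error_perturbation eta mu t e X : 0 < eta -> 0 < t ->
  (1 - mu) * dotv e X - eta / 2 * t ^+ 2 * dotv e e <=
  (1 - mu) ^+ 2 / (2 * eta * t ^+ 2) * dotv X X.
Proof.
move=> eta0 t0.
have sq : 0 <= (2 * eta * t ^+ 2)^-1 *
    dotv (eta * t ^+ 2 *: e - (1 - mu) *: X)
         (eta * t ^+ 2 *: e - (1 - mu) *: X).
  by rewrite mulr_ge0 ?dotvv_ge0// invr_ge0 !mulr_ge0 ?exprn_ge0// ltW.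
rewrite -subr_ge0; apply: (le_trans sq).
rewrite le_eqVlt; apply/orP; left; apply/eqP.
by rewrite !dotvE (dotvC X e); field; apply/andP; split; lra.
Qed.

End Lyapunov.

(** * Discrete Gronwall inequality *)

Section Gronwall.
Context {R : realType}.

(** The first bound uses [1 + eps <= exp eps].  Feeding it back into the
    telescoped recursion, in which [V] occurs on the right only through
    [eps * V], gives the second. *)
Lemma discrete_gronwall (V D eps : nat -> R) (E : R) :
  (forall k, 0 <= V k) -> (forall k, 0 <= D k) -> (forall k, 0 <= eps k) ->
  (forall k, V k.+1 + D k <= (1 + eps k) * V k) ->
  (forall n, \sum_(0 <= k < n) eps k <= E) ->
  forall n, V n <= V 0 * expR E /\
    \sum_(0 <= k < n) D k <= V 0 * (1 + E * expR E).
Proof.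
move=> V0 D0 eps0 step sumE.
have VE n : V n <= V 0 * expR E.
  suff : V n <= V 0 * expR (\sum_(0 <= k < n) eps k).
    by move/le_trans; apply; rewrite ler_wpM2l ?ler_expR.
  elim: n => [|n IH]; first by rewrite big_geq// expR0 mulr1.
  rewrite big_nat_recr//= expRD mulrA.
  apply: le_trans (_ : (1 + eps n) * V n <= _).
    by apply: le_trans (step n); rewrite lerDl.
  by rewrite mulrC ler_pM ?addr_ge0 ?expR_ge1Dx.
move=> n; split=> //.
have E0 : 0 <= V 0 * expR E by rewrite mulr_ge0 ?expR_ge0.
suff : V n + \sum_(0 <= k < n) D k
    <= V 0 + \sum_(0 <= k < n) eps k * (V 0 * expR E).
  have := ler_wpM2r E0 (sumE n); rewrite mulr_suml; have := V0 n; lra.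
elim: n => [|n IH]; first by rewrite !big_geq.
rewrite !big_nat_recr//=.
by have := step n; have := ler_wpM2l (eps0 n) (VE n); lra.
Qed.

(** Compare with the telescoping sum of [1 / (k + r - 1) - 1 / (k + r)].
    Omitting [k = 0] is what makes the bound [1 / r]. *)
Lemma sum_inv_sqr_le (r : R) (n : nat) : 0 < r ->
  \sum_(0 <= k < n) (if k == 0%N then 0 else ((k%:R + r) ^+ 2)^-1) <= r^-1.
Proof.
move=> r0.
suff H m : \sum_(0 <= k < m.+1)
    (if k == 0%N then 0 else ((k%:R + r) ^+ 2)^-1) <= r^-1 - (m%:R + r)^-1.
  case: n => [|n]; first by rewrite big_geq// invr_ge0 ltW.
  by apply: le_trans (H n) _; rewrite gerBl invr_ge0 addr_ge0// ltW.
elim: m => [|m IH]; first by rewrite big_nat1 add0r subrr.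
rewrite big_nat_recr//=; apply: le_trans (lerD IH (lexx _)) _.
have m0 : 0 < m%:R + r by rewrite ltr_wpDl.
have -> : m.+1%:R + r = (m%:R + r) + 1 by rewrite -natr1; ring.
move: (m%:R + r) m0 => s s0.
rewrite -subr_ge0 (_ : _ - _ = (s * (s + 1) ^+ 2)^-1); last first.
  by field; apply/andP; split; lra.
by rewrite invr_ge0 !mulr_ge0//; lra.
Qed.

End Gronwall.

(** * Convergence rates *)

Theorem theorem5p1 (R : realType) (p : nat)
  (F : 'rV[R]_p -> 'rV[R]_p) (T : 'rV[R]_p -> set 'rV[R]_p)
  (L rho kappa kappahat mu r eta gamma : R)
  (x xbar y u xi : nat -> 'rV[R]_p)
  (hzer : zer (op_sum F T) !=set0)
  (hF : lipschitz_cont F L)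
  (hrho : 0 <= rho)
  (hPhi : co_hypomonotone (op_sum F T) rho)
  (hkappa : 0 <= kappa) (hkappahat : 0 <= kappahat)
  (hcond : 128 * ((1 + 4 * kappa) * L ^+ 2 + 2 * kappahat) * rho ^+ 2 < 1)
  (hmu : 0 < mu < 1 / 2)
  (hr : 1 + 2 / mu <= r)
  (heta : 8 * rho < eta)
  (heta_bar : (eta%:E <= eta_bar L kappa kappahat)%E)
  (hgamma : gamma = (1 - 2 * mu) * eta / 6)
  (hgen : GFEGp F T eta gamma (tau_par mu r) (etahat_par eta mu r)
            (beta_par gamma rho mu r) x xbar y u xi)
  (hdir : direction_cond F kappa kappahat eta (tau_par mu r) x y u xi) :
  forall xstar, zer (op_sum F T) xstar ->
    let theta := theta_par mu in
    let R02 := R0sq eta mu r (F (x 0%N) + xi 0%N) (x 0%N) xstar in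
    (forall k : nat,
       enorm (F (x k) + xi k) ^+ 2 <=
         (6 * expR (theta / r) * R02) /
         (eta * mu ^+ 2 * (k%:R + r - 1) ^+ 2)) /\
    (\sum_(0 <= k <oo)
        ((mu * (k%:R + r) - 1) * enorm (F (x k) + xi k) ^+ 2)%:E <=
      ((4 * R02) / ((3 - 2 * mu) * (eta - 8 * rho)) *
        (1 + theta / r * expR (theta / r)))%:E)%E.
Proof.
move=> xs xs_zer theta R02.
have mu_in : 0 < mu < 1 / 2 by [].
have /andP[mu0 mu12] := mu_in.
have eta0 : 0 < eta by lra.
have step_le := eta_bar_sqr (ltW eta0) hkappa hkappahat heta_bar.
have mur : 2 + mu <= mu * r.
  have := ler_wpM2l (ltW mu0) hr.
  by rewrite (_ : mu * (1 + 2 / mu) = 2 + mu)//; field; lra.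
have r0 : 0 < r by rewrite -(pmulr_rgt0 _ mu0); lra.
pose t k : R := mu * (k%:R + r).
have t2 k : 2 + mu <= t k.
  by apply: le_trans mur _; rewrite /t ler_pM2l// lerDr.
have tS k : t k.+1 - mu = t k by rewrite /t -natr1; ring.
pose w k := F (x k) + xi k.
pose e k := F (x k) - u k.
pose q k := x k - xbar k.
pose X k := xbar k - xs.
have weE k : z_dir u xi k = w k - e k.
  by apply/rowP => i; rewrite !mxE; ring.
have tauE k : tau_par mu r k = (t k)^-1 by rewrite /tau_par div1r.
have t_neq0 k : t k != 0 by rewrite gt_eqF//; have := t2 k; lra.
have graw k : op_gra (op_sum F T) (x k, w k).
  by exists (xi k) => //; apply: (GFEGp_xi hgen).
have mono0 k : - rho * dotv (w k) (w k) <= dotv (w k) (q k + X k).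
  have := hPhi _ _ _ _ (graw k) xs_zer; rewrite subr0 enorm_sqr.
  by rewrite (_ : q k + X k = x k - xs)// /q /X addrA subrK.
pose a k := what_dir F x y xi k.+1.
have dE k : t k *: (x k.+1 - x k) = - q k - (t k * eta) *: a k
    + (4 * rho * (t k - 1) - gamma) *: (w k - e k).
  rewrite (GFEGp_x hgen) -weE /beta_par tauE /q /a.
  by apply/rowP => i; rewrite !mxE; field.
have xyE k : t k *: (x k.+1 - y k)
    = - eta *: (t k *: a k - (t k - 1) *: w k + (t k - 1) *: e k).
  rewrite (GFEGp_x hgen) (GFEGp_y hgen) /etahat_par tauE weE /a.
  by apply/rowP => i; rewrite !mxE; field.
have err k : t k ^+ 2 * (dotv (w k.+1 - a k) (w k.+1 - a k)
      + 4 * dotv (e k.+1) (e k.+1)) <=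
    dotv (t k *: a k - (t k - 1) *: w k) (t k *: a k - (t k - 1) *: w k)
    + (t k - 1) ^+ 2 * dotv (e k) (e k).
  have scaleE (s : R) (v : 'rV[R]_p) :
      s ^+ 2 * dotv v v = dotv (s *: v) (s *: v).
    by rewrite !dotvE mulrA.
  rewrite mulrDr mulrCA !scaleE.
  have waE : w k.+1 - a k = F (x k.+1) - F (y k).
    by rewrite /w /a /what_dir /= opprD addrACA subrr addr0.
  apply: (direction_error hkappa hkappahat step_le).
    rewrite -scaleE waE [(L * eta) ^+ 2]exprMn -[leRHS]mulrA.
    apply: le_trans (ler_wpM2l (sqr_ge0 _) (lipschitz_cont_sqr _ _ hF)) _.
    rewrite mulrCA ler_wpM2l ?sqr_ge0// !scaleE xyE scaleNr.
    by rewrite !(dotvNl, dotvNr) opprK.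
  rewrite -!scaleE.
  have /= := hdir k.+1 isT; rewrite !enorm_sqr -/(e k.+1) -/(w k) -/(a k) -waE.
  move=> /(ler_wpM2l (sqr_ge0 (t k)))/le_trans; apply.
  rewrite mulrDr (mulrCA _ kappa) lerD2l mulrCA ler_wpM2l//.
    by rewrite mulr_ge0 ?sqr_ge0.
  rewrite scaleE scalerBr scalerA.
  by rewrite tauE mulrBr mulr1 mulfV.
pose V k := lyapunov eta rho mu (t k - mu) (w k) (q k) (X k) (e k).
pose D k := (3 - 2 * mu) * (eta - 8 * rho) / 4 * ((t k - 1) * dotv (w k) (w k)).
(* The growth rate vanishes at 0 because the initial direction is exact. *)
pose eps k : R := theta * (if k == 0%N then 0 else ((k%:R + r) ^+ 2)^-1).
have s0 k : 0 <= t k - mu by have := t2 k; lra.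
have theta0 : 0 <= theta.
  by rewrite /theta /theta_par divr_ge0 ?mulr_ge0 ?sqr_ge0//; lra.
have VX k := lyapunov_ge_anchor (e k) mu_in hrho heta (s0 k) (mono0 k).
have V0 k : 0 <= V k.
  apply: le_trans (VX k).
  by rewrite mulr_ge0 ?dotvv_ge0// divr_ge0 ?mulr_ge0//; lra.
have D0 k : 0 <= D k.
  by rewrite /D !mulr_ge0 ?dotvv_ge0//; have := t2 k; lra.
have eps0 k : 0 <= eps k.
  by rewrite mulr_ge0//; case: ifP => // _; rewrite invr_ge0 sqr_ge0.
have stepV k : V k.+1 + D k <= (1 + eps k) * V k.
  have mono : - rho * dotv (w k.+1 - w k) (w k.+1 - w k)
      <= dotv (w k.+1 - w k) (x k.+1 - x k).
    by have := hPhi _ _ _ _ (graw k.+1) (graw k); rewrite enorm_sqr.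
  have := lyapunov_step mu_in (t2 k) hrho heta hgamma (dE k) mono
    (mono0 k) (err k).
  rewrite (_ : q k + (x k.+1 - x k) + gamma *: (w k - e k) = q k.+1); last first.
    by rewrite /q (GFEGp_xbar hgen) weE; apply/rowP => i; rewrite !mxE; ring.
  rewrite (_ : X k - gamma *: (w k - e k) = X k.+1); last first.
    by rewrite /X (GFEGp_xbar hgen) weE; apply/rowP => i; rewrite !mxE; ring.
  rewrite -{1}(tS k) -/(V k.+1) -/(V k) -/(D k) => /le_trans; apply.
  rewrite [leRHS]mulrDl mul1r -addrA lerD2l /eps.
  case: eqP => [->|/eqP k0].
    by rewrite mulr0 mul0r /e (GFEGp_u0 hgen) subrr !dotv0l !mulr0 subrr.
  (* [theta] is chosen so that the Young remainder is exactly the multiple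
     [eps] of the lower bound of [lyapunov_ge_anchor]. *)
  apply: le_trans (error_perturbation _ _ _ eta0 _) _; first by have := t2 k; lra.
  apply: le_trans (ler_wpM2l _ (VX k)); last first.
    by have := eps0 k; rewrite /eps (negbTE k0).
  rewrite [leRHS]mulrA ler_wpM2r ?dotvv_ge0// le_eqVlt; apply/orP; left; apply/eqP.
  have := t_neq0 k; rewrite /theta /theta_par /t mulf_eq0 negb_or => /andP[_ kr].
  by field; rewrite kr /=; lra.
have sum_eps n : \sum_(0 <= k < n) eps k <= theta / r.
  by rewrite /eps -mulr_sumr ler_wpM2l// sum_inv_sqr_le.
have gron := discrete_gronwall V0 D0 eps0 stepV sum_eps.
have V0_le : V 0%N <= R02.
  rewrite /V /lyapunov /R02 /R0sq /e (GFEGp_u0 hgen) subrr dotv0l mulr0 addr0.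
  rewrite /q (GFEGp_xbar0 hgen) subrr (dotvC _ 0) dotv0l mulr0 addr0.
  rewrite !enorm_sqr /X (GFEGp_xbar0 hgen) lerD2r -/(w 0%N).
  rewrite ler_wpM2r ?dotvv_ge0//.
  have h : 0 <= rho * ((t 0%N - mu) * (t 0%N - mu - 1)).
    by rewrite !mulr_ge0//; have := t2 0%N; lra.
  by move: h; rewrite /t add0r; lra.
split=> [k|].
  have [Vk _] := gron k.
  have Vw := lyapunov_ge_residual (e k) mu_in hrho heta (s0 k) (mono0 k).
  have sE : t k - mu = mu * (k%:R + r - 1) by rewrite /t; ring.
  have s_gt0 : 0 < mu * (k%:R + r - 1) by rewrite -sE; have := t2 k; lra.
  rewrite enorm_sqr -/(w k) ler_pdivlMr; last first.
    by rewrite -mulrA -exprMn mulr_gt0 ?exprn_gt0.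
  have := ler_wpM2r (expR_ge0 (theta / r)) V0_le.
  by move: Vw Vk; rewrite -/(V k) sE; lra.
apply: lime_le.
  apply: is_cvg_nneseries => n _ _.
  by rewrite lee_fin enorm_sqr mulr_ge0 ?dotvv_ge0//; have := t2 n; rewrite /t; lra.
apply: nearW => n.
rewrite sumEFin lee_fin.
have [_ sumD] := gron n.
have c0 : 0 < (3 - 2 * mu) * (eta - 8 * rho) / 4.
  by rewrite !mulr_gt0//; lra.
rewrite -(ler_pM2l c0) mulr_sumr.
rewrite (eq_bigr D) => [|k _]; last by rewrite enorm_sqr.
apply: le_trans sumD _.
have E0 : 0 <= 1 + theta / r * expR (theta / r).
  by rewrite addr_ge0// mulr_ge0 ?expR_ge0// divr_ge0// ltW.
apply: le_trans (ler_wpM2r E0 V0_le) _.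
rewrite mulrA ler_wpM2r// le_eqVlt; apply/orP; left; apply/eqP.
by field; apply/andP; split; lra.
Qed.
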